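(* (1) $\rho_Z$ and $\rho_T$ are commuting projectors on $\mathcal{G}$. Consequently every two-player game decomposes uniquely into a sum of 4 components (zero-sum-transitive, zero-sum-cyclic, cooperative-transitive, cooperative-cyclic): $$\mathcal{G}=(R_{\rho_Z}\cap R_{\rho_T})\oplus(R_{\rho_Z}\cap K_{\rho_T})\oplus(K_{\rho_Z}\cap R_{\rho_T})\oplus(K_{\rho_Z}\cap K_{\rho_T}).$$ (2) If moreover $(\mathcal{X}_1,\mu_1)=(\mathcal{X}_2,\mu_2)$, then $\rho_S$ is a well-defined projector on $\mathcal{G}$ which commutes with $\rho_Z$ and with $\rho_T$. Consequently every such game decomposes uniquely into a sum of 8 components ($\{$zero-sum, cooperative$\}\times\{$symmetric, antisymmetric$\}\times\{$transitive, cyclic$\}$): $$\mathcal{G}=\bigoplus_{\mathcal{C}_1\in\{R_{\rho_Z},K_{\rho_Z}\},\ \mathcal{C}_2\in\{R_{\rho_S},K_{\rho_S}\},\ \mathcal{C}_3\in\{R_{\rho_T},K_{\rho_T}\}}\mathcal{C}_1\cap\mathcal{C}_2\cap\mathcal{C}_3.$$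
   Context: The pure strategy sets $\mathcal{X}_1,\mathcal{X}_2$ of the two players are probability spaces with probability measures $\mu_1,\mu_2$. $\mathcal{G}$ is the real vector space of two-player games, i.e. pairs $f=(f_1,f_2)$ of functions $\mathcal{X}_1\times\mathcal{X}_2\to\mathbb{R}$, where $f_j(x,y)$ is the payoff to player $j$ when the players play $x$ and $y$. The payoff functions are taken to be jointly measurable, $\mu_1\otimes\mu_2$-integrable, and such that $f_j(x,\cdot)\in L^1(\mu_2)$ for every $x$ and $f_j(\cdot,y)\in L^1(\mu_1)$ for every $y$, so that all integrals below are defined everywhere. A projector on $\mathcal{G}$ is a linear operator $\rho:\mathcal{G}\to\mathcal{G}$ with $\rho^2=\rho$; $K_\rho$, $R_\rho$ denote its kernel and range (and $K_\rho=R_{\mathrm{Id}-\rho}$). For a function $g$ on $\mathcal{X}_1\times\mathcal{X}_2$: $\mathcal{N}_2g(x,y):=\int g(x,z)\,d\mu_2(z)$, $\mathcal{N}_1g(x,y):=\int g(z,y)\,d\mu_1(z)$, $\widehat{\mathcal{N}}:=\mathcal{N}_1+\mathcal{N}_2-\mathcal{N}_1\mathcal{N}_2$; and, when the two strategy spaces coincide, $g^T(x,y):=g(y,x)$. The operators are $$\rho_Z(f_1,f_2):=\tfrac12(f_1-f_2,\,f_2-f_1),\quad \rho_S(f_1,f_2):=\tfrac12(f_1+f_2^T,\,f_2+f_1^T),\quad \rho_T(f_1,f_2):=(\widehat{\mathcal{N}}f_1,\,\widehat{\mathcal{N}}f_2).$$ Games in $R_{\rho_Z}$, $K_{\rho_Z}$,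 $R_{\rho_S}$, $K_{\rho_S}$, $R_{\rho_T}$, $K_{\rho_T}$ are called zero-sum, cooperative, symmetric, antisymmetric, transitive and cyclic, respectively. *)

(* Defs.v *)
From HB Require Import structures.
From mathcomp Require Import all_boot all_order all_algebra.
From mathcomp Require Import all_classical all_reals all_analysis measurable_realfun.

Set Implicit Arguments.
Unset Strict Implicit.
Unset Printing Implicit Defensive.

Import Order.TTheory GRing.Theory Num.Theory.
Import numFieldNormedType.Exports.

Local Open Scope classical_set_scope.
Local Open Scope ring_scope.

Section projectors.
Context {R : pzRingType} {V : lmodType R}.
Implicit Types rho : V -> V.

Definition projector rho := linear rho /\ idempotent_fun rho.

Definition kernel_set rho : set V := [set f | rho f = 0].

Definition linear_subspace (C : set V) :=
  C 0 /\ forall (a : R) u v, C u -> C v -> C (a *: u + v).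

(* Internal direct sum of the subspaces C i of V. *)
Definition direct_sum (I : finType) (C : I -> set V) :=
  (forall i, linear_subspace (C i)) /\
  forall v, exists! g : {ffun I -> V}, (forall i, C i (g i)) /\ v = \sum_i g i.

Definition range_or_kernel rho (b : bool) : set V :=
  if b then range rho else kernel_set rho.

End projectors.

Lemma integrable_transpose (R : realType) (d1 d2 : measure_display)
    (X1 : measurableType d1) (X2 : measurableType d2)
    (mu1 : probability X1 R) (mu2 : probability X2 R) (g : X1 * X2 -> \bar R) :
  (mu1 \x mu2)%E.-integrable setT g ->
  (mu2 \x mu1)%E.-integrable setT (fun p => g (p.2, p.1)).
Proof.
move=> ig; have mg := measurable_int _ ig.
apply/integrable12ltyP; last by have /integrable21ltyP := ig; exact.
by apply: measurableT_comp mg _; exact: measurable_swap.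
Qed.

Section payoffs.
Context {R : realType} {d1 d2 : measure_display}.
Context {X1 : measurableType d1} {X2 : measurableType d2}.
Variables (mu1 : probability X1 R) (mu2 : probability X2 R).

(* Payoffs are genuine functions, not classes modulo a.e. equality; R^o is R
   seen as a module over itself, which makes the function space an lmodType. *)
Definition is_payoff (g : X1 * X2 -> R^o) : Prop :=
  [/\ measurable_fun setT (g : X1 * X2 -> R),
      (mu1 \x mu2)%E.-integrable setT (fun p => (g p)%:E),
      forall x, mu2.-integrable setT (fun y => (g (x, y))%:E) &
      forall y, mu1.-integrable setT (fun x => (g (x, y))%:E)].

Definition payoff_pred : {pred X1 * X2 -> R^o} := fun g => `[< is_payoff g >].

Record payoff := Payoff {
  payoff_fun :> X1 * X2 -> R^o;
  payoff_subproof : payoff_fun \in payoff_pred }.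

HB.instance Definition _ := [isSub for payoff_fun].
HB.instance Definition _ := [Choice of payoff by <:].

Lemma payoffP (g : payoff) : is_payoff g.
Proof. by case: g => g /= /asboolP. Qed.

Lemma payoff_submod_closed : submod_closed payoff_pred.
Proof.
have integrable_lin d (T : measurableType d) (mu : {measure set T -> \bar R})
    (a : R) (u v : T -> R) :
    mu.-integrable setT (EFin \o u) -> mu.-integrable setT (EFin \o v) ->
    mu.-integrable setT (fun x => (a * u x + v x)%:E).
  move=> iu iv.
  exact: (integrableD measurableT (integrableZl measurableT a iu) iv).
split=> [|a u v /asboolP[mu iu iu1 iu2] /asboolP[mv iv iv1 iv2]]; apply/asboolP.
  split.
  - exact: measurable_cst.
  - exact: integrable0.
  - by move=> x; exact: integrable0.
  - by move=> y; exact: integrable0.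
split; last 3 first.
- exact: integrable_lin iu iv.
- by move=> x; exact: integrable_lin (iu1 x) (iv1 x).
- by move=> y; exact: integrable_lin (iu2 y) (iv2 y).
by apply: measurable_funD => //; exact: measurable_funM.
Qed.

HB.instance Definition _ :=
  GRing.isSubmodClosed.Build _ _ payoff_pred payoff_submod_closed.
HB.instance Definition _ := [SubChoice_isSubLmodule of payoff by <:].

Definition game : lmodType R := (payoff * payoff)%type.

Lemma is_payoff_fst (h : X1 -> R) :
  mu1.-integrable setT (EFin \o h) -> is_payoff (fun p => h p.1).
Proof.
move=> ih; have mh : measurable_fun setT h.
  exact/measurable_EFinP/(measurable_int _ ih).
have mh1 : measurable_fun setT (fun p : X1 * X2 => h p.1).
  exact: measurableT_comp mh measurable_fst.
split=> //; last first.
  by move=> x; exact: (finite_measure_integrable_cst mu2 (h x) measurableT).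
apply/integrable12ltyP; first exact/measurable_EFinP.
have /integrableP[_] := ih; congr (_ < +oo)%E.
apply: eq_integral => x _; rewrite (integral_cst mu2 measurableT `|(h x)%:E|%E).
by rewrite [X in (_ * X)%E](@probability_setT) mule1.
Qed.

Lemma is_payoff_snd (h : X2 -> R) :
  mu2.-integrable setT (EFin \o h) -> is_payoff (fun p => h p.2).
Proof.
move=> ih; have mh : measurable_fun setT h.
  exact/measurable_EFinP/(measurable_int _ ih).
have mh2 : measurable_fun setT (fun p : X1 * X2 => h p.2).
  exact: measurableT_comp mh measurable_snd.
split=> //; last first.
  by move=> y; exact: (finite_measure_integrable_cst mu1 (h y) measurableT).
apply/integrable21ltyP; first exact/measurable_EFinP.
have /integrableP[_] := ih; congr (_ < +oo)%E.
apply: eq_integral => y _; rewrite (integral_cst mu1 measurableT `|(h y)%:E|%E).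
by rewrite [X in (_ * X)%E](@probability_setT) mule1.
Qed.

Lemma avg2_subproof (g : payoff) :
  (fun p => \int[mu2]_z (g (p.1, z) : R)) \in payoff_pred.
Proof.
have [_ ig ig1 _] := payoffP g; apply/asboolP.
apply: (is_payoff_fst (h := fun x => \int[mu2]_z (g (x, z) : R))).
have /= := integrable_fubini_F ig; congr (_.-integrable _ _).
apply/funext => x /=; rewrite /fubini_F /Rintegral fineK//.
exact: integrable_fin_num (ig1 x).
Qed.

Lemma avg1_subproof (g : payoff) :
  (fun p => \int[mu1]_z (g (z, p.2) : R)) \in payoff_pred.
Proof.
have [_ ig _ ig2] := payoffP g; apply/asboolP.
apply: (is_payoff_snd (h := fun y => \int[mu1]_z (g (z, y) : R))).
have /= := integrable_fubini_F (integrable_transpose ig).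
congr (_.-integrable _ _); apply/funext => y /=.
rewrite /fubini_F /Rintegral fineK//.
exact: integrable_fin_num (ig2 y).
Qed.

(* avg_j integrates out the strategy of player j and is constant in it. *)
Definition avg2 (g : payoff) : payoff := Payoff (avg2_subproof g).
Definition avg1 (g : payoff) : payoff := Payoff (avg1_subproof g).
Definition avg_hat (g : payoff) : payoff := avg1 g + avg2 g - avg1 (avg2 g).

Definition rhoZ (f : game) : game := 2^-1 *: (f.1 - f.2, f.2 - f.1).
Definition rhoT (f : game) : game := (avg_hat f.1, avg_hat f.2).

End payoffs.

Arguments rhoZ {R d1 d2 X1 X2} mu1 mu2 f.
Arguments rhoT {R d1 d2 X1 X2} mu1 mu2 f.

Section symmetric_games.
Context {R : realType} {d : measure_display} {X : measurableType d}.
Variable mu : probability X R.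

Lemma transpose_subproof (g : payoff mu mu) :
  (fun p => g (p.2, p.1)) \in payoff_pred mu mu.
Proof.
have [mg ig ig1 ig2] := payoffP g; apply/asboolP.
have mgT : measurable_fun setT (fun p : X * X => g (p.2, p.1) : R).
  by apply: measurableT_comp mg _; exact: measurable_swap.
by split=> //; exact: integrable_transpose ig.
Qed.

Definition transpose (g : payoff mu mu) : payoff mu mu :=
  Payoff (transpose_subproof g).

Definition rhoS (f : game mu mu) : game mu mu :=
  2^-1 *: (f.1 + transpose f.2, f.2 + transpose f.1).

End symmetric_games.

Arguments rhoS {R d X} mu f.

(* Main.v *)
(* rho_Z and rho_S both have the form (Id + s)/2 for a linear involution s of the
   space of games: s (f1, f2) = (- f2, - f1), resp. s (f1, f2) = (f2^T, f1^T).
   Hence they are projectors, and they commute with every linear map commuting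
   with s.  The averages N_1 and N_2 are idempotent, commute by Fubini, and
   satisfy N_j N^ = N_j, so N^ is idempotent; transposition exchanges N_1 and
   N_2 and therefore commutes with N^.  Finally, the products of the maps rho and
   Id - rho, taken over a family of commuting projectors, are mutually
   annihilating and sum to the identity, so their ranges form a direct sum. *)
Require Import Defs.
From HB Require Import structures.
From mathcomp Require Import all_boot all_order all_algebra.
From mathcomp Require Import all_classical all_reals all_analysis.

Set Implicit Arguments.
Unset Strict Implicit.
Unset Printing Implicit Defensive.

Import GRing.Theory Num.Theory.

Local Open Scope classical_set_scope.
Local Open Scope ring_scope.

(** * Direct sums described by their component maps *)

Section resolutions.
Context {R : pzRingType} {V : lmodType R}.
Implicit Types (rho : V -> V) (u v : V).

(** Bundles a linearity proof, so that the [raddf] lemmas apply to an otherwise bare function. *)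
Definition linear_map rho (lin : linear rho) : {linear V -> V} :=
  HB.pack rho (GRing.isLinear.Build R V V *:%R rho lin).

(* The P i are the component maps of the direct sum of the C i. *)
Definition resolution (I : finType) (C : I -> set V) (P : I -> V -> V) :=
  [/\ forall i, linear (P i),
      forall i v, C i v <-> P i v = v,
      forall i j v, i != j -> P i (P j v) = 0 &
      forall v, \sum_i P i v = v].

(** Expanding [P i v] by the sum identity leaves only its [i]-th term. *)
Lemma resolution_idem (I : finType) (C : I -> set V) (P : I -> V -> V) i v :
  resolution C P -> P i (P i v) = P i v.
Proof.
move=> [_ _ orth sumP]; rewrite -[RHS]sumP (bigD1 i)//= big1 ?addr0// => j.
exact: orth.
Qed.

(** The maps [P i] themselves give a decomposition. For uniqueness, [P i] applied to any
    decomposition fixes the [i]-th term and kills the others. *)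
Lemma resolution_direct_sum (I : finType) (C : I -> set V) (P : I -> V -> V) :
  resolution C P -> direct_sum C.
Proof.
move=> resP; have [lin CP orth sumP] := resP.
pose L i := linear_map (lin i).
have P0 i : P i 0 = 0 := raddf0 (L i).
split=> [i|v].
  split=> [|a u v /CP uE /CP vE]; apply/CP; first exact: P0.
  by rewrite lin uE vE.
exists [ffun i => P i v]; split=> [|g [Cg ->]].
  split=> [i|]; first by apply/CP; rewrite ffunE (resolution_idem _ _ resP).
  by rewrite -[LHS]sumP; apply: eq_bigr => i _; rewrite ffunE.
apply/ffunP => i; rewrite ffunE.
have -> : P i (\sum_j g j) = \sum_j P i (g j) := raddf_sum (L i) _ _ _.
rewrite (bigD1 i)//= big1 ?addr0 => [|j ji]; first exact/CP/Cg.
by have /CP <- := Cg j; apply: orth; rewrite eq_sym.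
Qed.

Lemma resolution_prod (I J : finType) (C : I -> set V) (D : J -> set V)
    (P : I -> V -> V) (Q : J -> V -> V) :
  resolution C P -> resolution D Q ->
  (forall i j, P i \o Q j =1 Q j \o P i) ->
  resolution (fun ij : I * J => C ij.1 `&` D ij.2)
    (fun ij => P ij.1 \o Q ij.2).
Proof.
move=> resP resQ PQ.
have [linP CP orthP sumP] := resP; have [linQ DQ orthQ sumQ] := resQ.
pose L i := linear_map (linP i).
have P0 i : P i 0 = 0 := raddf0 (L i).
have {}PQ i j v : P i (Q j v) = Q j (P i v) := PQ i j v.
split=> [[i j] a u v|[i j] v|[i j] [i' j'] v|v] /=.
- by rewrite linQ linP.
- split=> [[/CP Cv /DQ Dv]|PQv]; first by rewrite Dv.
  split; first by apply/CP; rewrite -PQv (resolution_idem _ _ resP).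
  by apply/DQ; rewrite -PQv PQ (resolution_idem _ _ resQ).
(* Distinct pairs differ in some coordinate; commutation brings the two maps [P], or the two maps
   [Q], next to each other. *)
- rewrite -pair_eqE negb_and => /orP[ii'|jj'].
  + by rewrite -PQ orthP.
  + by rewrite -PQ orthQ// !P0.
rewrite -(pair_bigA _ (fun i j => P i (Q j v)))/= -[RHS]sumP.
apply: eq_bigr => i _; rewrite -[in RHS](sumQ v).
exact/esym/(raddf_sum (L i)).
Qed.

Definition component rho (b : bool) v : V := if b then rho v else v - rho v.

Lemma projector_resolution rho :
  projector rho -> resolution (range_or_kernel rho) (component rho).
Proof.
move=> [lin idem]; pose L := linear_map lin.
have rhoB u v : rho (u - v) = rho u - rho v := raddfB L _ _.
have {}idem v : rho (rho v) = rho v := idem v.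
split=> [[] a u v|[] v|[] [] v //= _|v]; rewrite /component.
- exact: lin.
- by rewrite lin scalerBr opprD addrACA.
- by split=> [[u _ <-]|<-]; [exact: idem|exists v].
- split=> [/= ->|]; first by rewrite subr0.
  by move=> <-; rewrite /range_or_kernel /kernel_set /= rhoB idem subrr.
- by rewrite rhoB idem subrr.
- by rewrite idem subrr.
- by rewrite big_bool /= addrC subrK.
Qed.

(** Each component map is a linear combination of the identity and its projector. Only the case of
    two complements needs its terms reordered. *)
Lemma component_comm (rho1 rho2 : V -> V) (b c : bool) :
  linear rho1 -> linear rho2 -> rho1 \o rho2 =1 rho2 \o rho1 ->
  component rho1 b \o component rho2 c =1 component rho2 c \o component rho1 b.
Proof.
move=> lin1 lin2 comm v.
have rho1B u w : rho1 (u - w) = rho1 u - rho1 w := raddfB (linear_map lin1) u w.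
have rho2B u w : rho2 (u - w) = rho2 u - rho2 w := raddfB (linear_map lin2) u w.
have {}comm u : rho1 (rho2 u) = rho2 (rho1 u) := comm u.
case: b; case: c; rewrite /component /= ?rho1B ?rho2B ?comm//.
by rewrite !opprB !addrA addrAC [RHS]addrAC; congr (_ + _); rewrite addrAC.
Qed.

End resolutions.

(** * Projectors built from linear involutions *)

Section half_sum.
Context {R : numFieldType} {V : lmodType R}.
Implicit Types s t : V -> V.

Definition half_sum s v : V := 2^-1 *: (v + s v).

(** Idempotence: [s] only swaps the summands of [v + s v], so it fixes [half_sum s v], and averaging
    a fixed point with itself changes nothing. *)
Lemma half_sum_projector s : linear s -> s \o s =1 id -> projector (half_sum s).
Proof.
move=> lin inv; pose L := linear_map lin.
split=> [a u v|v].
  rewrite /half_sum lin addrACA -[a *: u + _]scalerDr [LHS]scalerDr !scalerA.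
  by rewrite [a * _]mulrC.
rewrite /half_sum /=.
have -> : s (2^-1 *: (v + s v)) = 2^-1 *: (s v + s (s v)).
  by rewrite -(raddfD L); exact: (linearZ_LR L).
have -> : s (s v) = v := inv v.
by rewrite [s v + v]addrC -mulr2n -scaler_nat scalerA mulVf ?pnatr_eq0// scale1r.
Qed.

Lemma half_sum_comm s t :
  linear t -> s \o t =1 t \o s -> half_sum s \o t =1 t \o half_sum s.
Proof.
move=> lin comm v; pose L := linear_map lin; rewrite /half_sum /=.
have -> : s (t v) = t (s v) := comm v.
by rewrite -(raddfD L); exact/esym/(linearZ_LR L).
Qed.

End half_sum.

(** * Averaging operators, [rhoT] and [rhoZ] *)

Section averages.
Context {R : realType} {d1 d2 : measure_display}.
Context {X1 : measurableType d1} {X2 : measurableType d2}.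
Variables (mu1 : probability X1 R) (mu2 : probability X2 R).
Local Notation payoff := (payoff mu1 mu2).
Implicit Types g : payoff.

Lemma payoff_ext g g' : (forall p, g p = g' p) -> g = g'.
Proof. by move=> gg'; apply/val_inj/funext. Qed.

Lemma Rintegral_probability_cst d (T : measurableType d) (mu : probability T R)
  (c : R) : \int[mu]_(x in setT) c = c.
Proof. by rewrite Rintegral_cst// [X in fine X](@probability_setT) mulr1. Qed.

(** Every section of a payoff is integrable, so additivity of the integral holds at every point, not
    just almost everywhere. *)
Lemma avg1_linear : linear (@avg1 R d1 d2 X1 X2 mu1 mu2).
Proof.
move=> a g g'; apply: payoff_ext => -[x y] /=.
have [_ _ _ ig] := payoffP g; have [_ _ _ ig'] := payoffP g'.
rewrite -[RHS]/(a * (\int[mu1]_z (g (z, y) : R)) + \int[mu1]_z (g' (z, y) : R)).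
rewrite -(RintegralZl _ _ (ig y))// -RintegralD//; last exact: ig'.
exact: integrableZl (ig y).
Qed.

Lemma avg2_linear : linear (@avg2 R d1 d2 X1 X2 mu1 mu2).
Proof.
move=> a g g'; apply: payoff_ext => -[x y] /=.
have [_ _ ig _] := payoffP g; have [_ _ ig' _] := payoffP g'.
rewrite -[RHS]/(a * (\int[mu2]_z (g (x, z) : R)) + \int[mu2]_z (g' (x, z) : R)).
rewrite -(RintegralZl _ _ (ig x))// -RintegralD//; last exact: ig'.
exact: integrableZl (ig x).
Qed.

HB.instance Definition _ := GRing.isLinear.Build R payoff payoff *:%R
  (@avg1 R d1 d2 X1 X2 mu1 mu2) avg1_linear.
HB.instance Definition _ := GRing.isLinear.Build R payoff payoff *:%R
  (@avg2 R d1 d2 X1 X2 mu1 mu2) avg2_linear.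

Lemma avg1_idem g : avg1 (avg1 g) = avg1 g.
Proof. by apply: payoff_ext => p /=; rewrite Rintegral_probability_cst. Qed.

Lemma avg2_idem g : avg2 (avg2 g) = avg2 g.
Proof. by apply: payoff_ext => p /=; rewrite Rintegral_probability_cst. Qed.

Lemma avg2_avg1 g : avg2 (avg1 g) = avg1 (avg2 g).
Proof.
apply: payoff_ext => p /=; have [_ ig ig1 ig2] := payoffP g.
rewrite /Rintegral; congr fine.
under eq_integral do rewrite fineK ?(integrable_fin_num _ (ig2 _))//.
under [RHS]eq_integral do rewrite fineK ?(integrable_fin_num _ (ig1 _))//.
by rewrite -(Fubini ig).
Qed.

Lemma avg_hat_linear : linear (@avg_hat R d1 d2 X1 X2 mu1 mu2).
Proof.
move=> a g g'; rewrite /avg_hat !linearP /=.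
by rewrite [X in X + _]addrACA [LHS]addrACA !scalerDr.
Qed.

HB.instance Definition _ := GRing.isLinear.Build R payoff payoff *:%R
  (@avg_hat R d1 d2 X1 X2 mu1 mu2) avg_hat_linear.

(** [avg1] sends [avg2 g] to [avg1 (avg2 g)], which cancels the correction term. *)
Lemma avg1_avg_hat g : avg1 (avg_hat g) = avg1 g.
Proof. by rewrite /avg_hat raddfB raddfD /= !avg1_idem addrK. Qed.

Lemma avg2_avg_hat g : avg2 (avg_hat g) = avg2 g.
Proof.
by rewrite /avg_hat raddfB raddfD /= !avg2_avg1 avg2_idem addrC addKr.
Qed.

(** [avg_hat] depends on its argument only through the two averages, and these agree for [g] and
    [avg_hat g]. *)
Lemma avg_hat_idem g : avg_hat (avg_hat g) = avg_hat g.
Proof. by rewrite {1}/avg_hat avg1_avg_hat avg2_avg_hat. Qed.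

Lemma rhoT_linear : linear (rhoT mu1 mu2).
Proof. by move=> a f f'; rewrite /rhoT /= !avg_hat_linear. Qed.

Lemma rhoT_projector : projector (rhoT mu1 mu2).
Proof.
by split=> [|f]; [exact: rhoT_linear|rewrite /rhoT /= !avg_hat_idem].
Qed.

Definition negate_exchange (f : game mu1 mu2) : game mu1 mu2 := (- f.2, - f.1).

Lemma negate_exchange_linear : linear negate_exchange.
Proof. by move=> a f f'; rewrite /negate_exchange /= !linearP. Qed.

Lemma rhoZ_half_sum : rhoZ mu1 mu2 = half_sum negate_exchange.
Proof. by []. Qed.

Lemma rhoZ_projector : projector (rhoZ mu1 mu2).
Proof.
apply: half_sum_projector negate_exchange_linear _ => f.
by rewrite /negate_exchange /= !opprK; case: f.
Qed.

(** [rhoT] applies one linear operator to both payoffs, hence respects exchange and negation. *)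
Lemma rhoZ_rhoT : rhoZ mu1 mu2 \o rhoT mu1 mu2 =1 rhoT mu1 mu2 \o rhoZ mu1 mu2.
Proof.
rewrite rhoZ_half_sum; apply: half_sum_comm rhoT_linear _ => f.
by rewrite /negate_exchange /rhoT /= !raddfN.
Qed.

End averages.

(** * Transposition and [rhoS] *)

Section transposition.
Context {R : realType} {d : measure_display} {X : measurableType d}.
Variable mu : probability X R.
Implicit Types g : payoff mu mu.

Lemma transpose_linear : linear (@transpose R d X mu).
Proof. by move=> a g g'; apply: payoff_ext. Qed.

HB.instance Definition _ := GRing.isLinear.Build R (payoff mu mu)
  (payoff mu mu) *:%R (@transpose R d X mu) transpose_linear.

Lemma transposeK g : transpose (transpose g) = g.
Proof. by apply: payoff_ext => -[]. Qed.

Lemma transpose_avg1 g : transpose (avg1 g) = avg2 (transpose g).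
Proof. exact: payoff_ext. Qed.

Lemma transpose_avg2 g : transpose (avg2 g) = avg1 (transpose g).
Proof. exact: payoff_ext. Qed.

Lemma transpose_avg_hat g : transpose (avg_hat g) = avg_hat (transpose g).
Proof.
(* Transposition reverses the product of the two averages; [avg2_avg1] restores its order. *)
rewrite /avg_hat raddfB raddfD /= !(transpose_avg1, transpose_avg2) avg2_avg1.
by rewrite [avg2 _ + _]addrC.
Qed.

Definition transpose_exchange (f : game mu mu) : game mu mu :=
  (transpose f.2, transpose f.1).

Lemma transpose_exchange_linear : linear transpose_exchange.
Proof. by move=> a f f'; rewrite /transpose_exchange /= !linearP. Qed.

Lemma rhoS_half_sum : rhoS mu = half_sum transpose_exchange.
Proof. by []. Qed.

Lemma rhoS_projector : projector (rhoS mu).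
Proof.
apply: half_sum_projector transpose_exchange_linear _ => f.
by rewrite /transpose_exchange /= !transposeK; case: f.
Qed.

(** Two uses of [half_sum_comm] reduce this to the involutions, whose composites both negate and
    transpose each payoff in place. *)
Lemma rhoS_rhoZ : rhoS mu \o rhoZ mu mu =1 rhoZ mu mu \o rhoS mu.
Proof.
rewrite rhoS_half_sum; apply: half_sum_comm (proj1 (rhoZ_projector mu mu)) _ => f.
rewrite rhoZ_half_sum; apply/esym; apply: half_sum_comm transpose_exchange_linear _ f => f.
by rewrite /negate_exchange /transpose_exchange /= !raddfN.
Qed.

Lemma rhoS_rhoT : rhoS mu \o rhoT mu mu =1 rhoT mu mu \o rhoS mu.
Proof.
rewrite rhoS_half_sum; apply: half_sum_comm (@rhoT_linear _ _ _ _ _ mu mu) _ => f.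
by rewrite /transpose_exchange /rhoT /= !transpose_avg_hat.
Qed.

End transposition.

Theorem corollary3p6 (R : realType) :
  (forall (d1 d2 : measure_display)
          (X1 : measurableType d1) (X2 : measurableType d2)
          (mu1 : probability X1 R) (mu2 : probability X2 R),
     [/\ projector (rhoZ mu1 mu2),
         projector (rhoT mu1 mu2),
         rhoZ mu1 mu2 \o rhoT mu1 mu2 =1 rhoT mu1 mu2 \o rhoZ mu1 mu2 &
         direct_sum (fun b : bool * bool =>
           range_or_kernel (rhoZ mu1 mu2) b.1 `&`
           range_or_kernel (rhoT mu1 mu2) b.2)])
  /\
  (forall (d : measure_display) (X : measurableType d) (mu : probability X R),
     [/\ projector (rhoS mu),
         rhoS mu \o rhoZ mu mu =1 rhoZ mu mu \o rhoS mu,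
         rhoS mu \o rhoT mu mu =1 rhoT mu mu \o rhoS mu &
         direct_sum (fun b : bool * bool * bool =>
           range_or_kernel (rhoZ mu mu) b.1.1 `&`
           range_or_kernel (rhoS mu) b.1.2 `&`
           range_or_kernel (rhoT mu mu) b.2)]).
Proof.
split=> [d1 d2 X1 X2 mu1 mu2|d X mu].
  have pZ := rhoZ_projector mu1 mu2; have pT := rhoT_projector mu1 mu2.
  have ZT := @rhoZ_rhoT _ _ _ _ _ mu1 mu2; split=> //.
  apply/resolution_direct_sum.
  apply: resolution_prod (projector_resolution pZ) (projector_resolution pT) _.
  by move=> b c; exact: component_comm pZ.1 pT.1 ZT.
have pZ := rhoZ_projector mu mu; have pT := rhoT_projector mu mu.
have pS := rhoS_projector mu; have ZT := @rhoZ_rhoT _ _ _ _ _ mu mu.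
have SZ := @rhoS_rhoZ _ _ _ mu; have ST := @rhoS_rhoT _ _ _ mu; split=> //.
have ZS : rhoZ mu mu \o rhoS mu =1 rhoS mu \o rhoZ mu mu := fsym SZ.
have resZS := resolution_prod (projector_resolution pZ)
  (projector_resolution pS) (fun b c => component_comm b c pZ.1 pS.1 ZS).
apply/resolution_direct_sum.
apply: resolution_prod resZS (projector_resolution pT) _ => -[b b'] c f /=.
(* The [rhoT] component moves past that of [rhoS] first, then past that of [rhoZ]. *)
have /= -> := component_comm b' c pS.1 pT.1 ST f.
exact: (component_comm b c pZ.1 pT.1 ZT).
Qed.
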